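(* There exist universal constants $C, C' > 0$ such that the following holds. Let $V \in \mathbb{R}^{d \times n}$ be a frame that is $\varepsilon$-doubly balanced, for some $\varepsilon \ge 0$, and satisfies $(1-\lambda)$-$\infty$-expansion, for some $0 < \lambda \le 1$. If $\lambda^{2} \ge C \varepsilon$, then there is a frame scaling solution $(L, R)$ for $V$ satisfying \[ \| L - I_{d} \|_{\mathrm{op}} \le C' \, \frac{\varepsilon}{\lambda} . \]
   Context: A frame is a matrix $V = (v_1, \dots, v_n) \in \mathbb{R}^{d\times n}$ whose columns $v_j$ span $\mathbb{R}^d$. Its size is $s(V) := \|V\|_F^2$, and its error matrices are \[ E(V) := d \cdot V V^T - s(V) I_d, \qquad F(V) := \operatorname{diag}(n \cdot V^T V - s(V) I_n), \] where for a square matrix $A$, $\operatorname{diag}(A)$ is the diagonal matrix with the same diagonal as $A$. $V$ is $\varepsilon$-doubly balanced if $\max\{\|E(V)\|_{\mathrm{op}}, \|F(V)\|_{\mathrm{op}}\} \le s(V)\cdot \varepsilon$, and doubly balanced if this holds with $\varepsilon = 0$. $V$ satisfies $(1-\lambda)$-$\infty$-expansion if for all $y \in \mathbb{R}^n$ with $\sum_j y_j = 0$ and $\|y\|_\infty \le 1$, \[ \Big\| \sum_{j=1}^n y_j v_j v_j^T \Big\|_{\mathrm{op}} \le \frac{s(V)(1-\lambda)}{d} . \] A frame scaling solution for $V$ is a pair $(L, R)$ with $L \in \mathbb{R}^{d\times d}$ and $R \in \mathbb{R}^{n\times n}$ diagonal such that $U := L V R$ is doubly balanced, i.e. $U U^T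 = \frac{s(U)}{d} I_d$ and $\|u_j\|_2^2 = \frac{s(U)}{n}$ for all $j \in [n]$ (with $L,R$ invertible). $\|\cdot\|_{\mathrm{op}}$ is the operator norm and $\|\cdot\|_F$ the Frobenius norm. *)

(* Defs.v *)
From mathcomp Require Import all_boot all_order all_algebra.
From mathcomp Require Import classical_sets reals normedtype.

Set Implicit Arguments.
Unset Strict Implicit.
Unset Printing Implicit Defensive.

Import Order.TTheory GRing.Theory Num.Theory.

Local Open Scope classical_set_scope.
Local Open Scope ring_scope.

Definition l2norm (R : realType) (m : nat) (x : 'cV[R]_m) : R :=
  Num.sqrt (\sum_(i < m) x i 0 ^+ 2).

Definition frob_norm (R : realType) (m n : nat) (A : 'M[R]_(m, n)) : R :=
  Num.sqrt (\sum_(i < m) \sum_(j < n) A i j ^+ 2).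

Definition op_norm (R : realType) (m n : nat) (A : 'M[R]_(m, n)) : R :=
  sup [set l2norm (A *m x) | x in [set x : 'cV[R]_n | l2norm x <= 1]].

Definition diag_part (R : realType) (n : nat) (A : 'M[R]_n) : 'M[R]_n :=
  diag_mx (\row_j A j j).

(* row_full V^T: the rows of V^T, i.e. the columns of V, span R^d *)
Definition frame (R : realType) (d n : nat) (V : 'M[R]_(d, n)) : Prop :=
  row_full V^T.

Definition frame_size (R : realType) (d n : nat) (V : 'M[R]_(d, n)) : R :=
  frob_norm V ^+ 2.

Definition errE (R : realType) (d n : nat) (V : 'M[R]_(d, n)) : 'M[R]_d :=
  d%:R *: (V *m V^T) - (frame_size V)%:M.

Definition errF (R : realType) (d n : nat) (V : 'M[R]_(d, n)) : 'M[R]_n :=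
  diag_part (n%:R *: (V^T *m V) - (frame_size V)%:M).

Definition eps_doubly_balanced (R : realType) (d n : nat) (eps : R)
    (V : 'M[R]_(d, n)) : Prop :=
  Num.max (op_norm (errE V)) (op_norm (errF V)) <= frame_size V * eps.

Definition doubly_balanced (R : realType) (d n : nat) (V : 'M[R]_(d, n)) :
    Prop :=
  eps_doubly_balanced 0 V.

(* (1 - lam)-oo-expansion; [mx_norm y] is the largest absolute value of an
   entry of y. *)
Definition infty_expansion (R : realType) (d n : nat) (lam : R)
    (V : 'M[R]_(d, n)) : Prop :=
  forall y : 'cV[R]_n, \sum_(j < n) y j 0 = 0 -> mx_norm y <= 1 ->
    op_norm (\sum_(j < n) y j 0 *: (col j V *m (col j V)^T))
      <= frame_size V * (1 - lam) / d%:R.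

Definition frame_scaling_solution (R : realType) (d n : nat)
    (V : 'M[R]_(d, n)) (L : 'M[R]_d) (S : 'M[R]_n) : Prop :=
  [/\ L \in unitmx, is_diag_mx S, S \in unitmx &
      doubly_balanced (L *m V *m S)].

Section OpNorm.
Variable R : realType.

Lemma l2norm0 m : l2norm (0 : 'cV[R]_m) = 0.
Proof. by rewrite /l2norm big1 ?sqrtr0// => i _; rewrite mxE expr0n. Qed.

Lemma ler_norm_l2norm m (x : 'cV[R]_m) i : `|x i 0| <= l2norm x.
Proof.
rewrite -sqrtr_sqr ler_wsqrtr// (bigD1 i)//= lerDl.
by apply: sumr_ge0 => j _; exact: sqr_ge0.
Qed.

Lemma op_norm_has_sup m n (A : 'M[R]_(m, n)) :
  has_sup [set l2norm (A *m x) | x in [set x : 'cV[R]_n | l2norm x <= 1]].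
Proof.
split; first by exists (l2norm (A *m 0)), 0; rewrite //= l2norm0.
exists (Num.sqrt (\sum_i (\sum_j `|A i j|) ^+ 2)) => _ [x /= x1 <-].
apply/ler_wsqrtr/ler_sum => i _; rewrite -[_ ^+ 2]real_normK ?num_real//.
rewrite lerXn2r ?nnegrE ?sumr_ge0// mxE.
apply: le_trans (ler_norm_sum _ _ _) _; apply: ler_sum => j _.
by rewrite normrM ler_piMr// (le_trans (ler_norm_l2norm x j)).
Qed.

Lemma op_norm_le0 m n (A : 'M[R]_(m, n)) : op_norm A <= 0 <-> A = 0.
Proof.
split=> [A0|->]; last first.
  apply: ge_sup; first by case: (op_norm_has_sup (0 : 'M[R]_(m, n))).
  by move=> _ [x _ <-]; rewrite mul0mx l2norm0.
apply/matrixP => i j; rewrite mxE; apply/eqP; rewrite -normr_le0.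
apply: le_trans A0; apply: le_trans (_ : l2norm (A *m delta_mx j 0) <= _).
  by rewrite -colE (le_trans _ (ler_norm_l2norm _ i))// mxE.
apply: ub_le_sup; first by case: (op_norm_has_sup A).
exists (delta_mx j 0) => //=.
rewrite /l2norm (bigD1 j)//= big1 ?mxE ?eqxx ?expr1n ?addr0 ?sqrtr1// => k kj.
by rewrite mxE (negbTE kj) expr0n.
Qed.

Lemma doubly_balancedP d n (V : 'M[R]_(d, n)) : (0 < d)%N -> (0 < n)%N ->
  doubly_balanced V <->
  V *m V^T = (frame_size V / d%:R)%:M /\
  (forall j, l2norm (col j V) ^+ 2 = frame_size V / n%:R).
Proof.
move=> d0 n0; rewrite /doubly_balanced /eps_doubly_balanced mulr0 ge_max.
have du : (d%:R : R) != 0 by rewrite pnatr_eq0 -lt0n.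
have nu : (n%:R : R) != 0 by rewrite pnatr_eq0 -lt0n.
have E0 : errE V = 0 <-> V *m V^T = (frame_size V / d%:R)%:M.
  rewrite /errE; split=> [/eqP|->].
    rewrite subr_eq0 => /eqP e.
    by rewrite mulrC -scale_scalar_mx -e scalerA mulVf// scale1r.
  by rewrite scale_scalar_mx mulrCA divff// mulr1 subrr.
have VV j : (V^T *m V) j j = l2norm (col j V) ^+ 2.
  rewrite /l2norm sqr_sqrtr ?sumr_ge0// => [|i _]; last exact: sqr_ge0.
  by rewrite mxE; apply: eq_bigr => i _; rewrite !mxE expr2.
have Fjj j : errF V j j = n%:R * l2norm (col j V) ^+ 2 - frame_size V.
  by rewrite !mxE eqxx !mulr1n -VV mxE.
have F0 : errF V = 0 <->
    forall j, l2norm (col j V) ^+ 2 = frame_size V / n%:R.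
  split=> [e j|e].
    move/eqP: (Fjj j); rewrite e mxE eq_sym subr_eq0 => /eqP <-.
    by rewrite mulrC mulKf.
  apply/matrixP => i j; case: (eqVneq i j) => [->|ij].
    by rewrite Fjj e mulrCA divff// mulr1 subrr mxE.
  by rewrite mxE (negbTE ij) mulr0n mxE.
split=> [/andP[/op_norm_le0/E0 e /op_norm_le0/F0 f]//|[/E0 e /F0 f]].
by apply/andP; split; apply/op_norm_le0.
Qed.

End OpNorm.

(* Main.v *)
(** Put s = s(V), P z = (d/s) V diag(z) V^T and
tau_j(z) = (n/s) v_j^T P(z)^-1 v_j.  A positive z with z_j tau_j(z) = 1 for all j
yields the scaling solution L = P(z)^(-1/2), S = diag(z)^(1/2).  Since
sum_j z_j tau_j(z) = n, the map G(z)_j = z_j + 1 - z_j tau_j(z) preserves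
sum_j z_j, and the solutions z are its fixed points.  Near z = 1,
G(z)_j - G(w)_j is (n/s) v_j^T P(z - w) v_j up to an error
O(eps/lam) |z - w|_oo; as z - w has zero sum, expansion bounds the main term by
(1 - lam) |z - w|_oo.  As eps/lam is small compared with lam, G contracts by
1 - lam/2 on the sup-norm ball of radius 8 eps/lam around 1, and it moves 1 by at
most 4 eps.  The fixed point satisfies |P z - 1|_op <= 9 eps/lam.  The square root
of a matrix close to the identity is again found by contraction, in the operator
norm, so that no constant depends on the dimension. *)
From HB Require Import structures.
Require Import Defs.
From mathcomp Require Import all_boot all_order all_algebra.
From mathcomp Require Import boolp classical_sets functions reals.
From mathcomp Require Import interval_inference topology normedtype sequences.
From mathcomp Require Import ring lra.

Set Implicit Arguments.
Unset Strict Implicit.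
Unset Printing Implicit Defensive.

Import Order.TTheory GRing.Theory Num.Theory.
Import numFieldNormedType.Exports.

Local Open Scope ring_scope.

(* Matrices have complete and normed structures, but no declared join. *)
HB.instance Definition _ (R : realType) (m n : nat) :=
  Complete.on 'M[R]_(m, n).

(** * Closed sublevel sets and fixed points in a norm equivalent to the sup norm *)

Section FixedPoint.
Variable R : realType.

(** Exchanging [x] and [y] turns the one-sided bound into a two-sided one, so [g] is continuous and
    the set is the preimage of a closed half-line. *)
Lemma closed_lipschitz_le (X : normedModType R) (g : X -> R) (c r : R) :
  (forall x y, g x - g y <= c * `|x - y|) ->
  closed [set x | g x <= r]%classic.
Proof.
move=> gc; apply: (@preimage_closed _ _ g [set x | x <= r]%classic); last first.
  exact: closed_le.
move=> x _; apply/cvgrPdist_le => /= e e0.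
(* [c] may be zero or negative; [|c| + 1] is a larger constant that can be divided by. *)
have c1 : 0 < `|c| + 1 by rewrite ltr_pwDr.
near=> t.
have xt : (`|c| + 1) * `|x - t| <= e.
  rewrite mulrC -ler_pdivlMr//; near: t.
  by apply: cvgr_dist_le => //; rewrite divr_gt0.
have ct : c * `|x - t| <= e.
  by apply: le_trans xt; rewrite ler_wpM2r// (le_trans (ler_norm c))// lerDl.
rewrite ler_norml; apply/andP; split; last exact: le_trans (gc _ _) ct.
by rewrite lerNl opprB (le_trans (gc _ _))// distrC.
Unshelve. all: by end_near. Qed.

(* An iterate of [f] contracts the sup norm, and [f] permutes the fixed points
   of its iterates, of which there is only one. *)
Lemma equiv_norm_fixed_point (m n : nat) (N : 'M[R]_(m, n) -> R) (c q : R)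
    (U : set 'M[R]_(m, n)) (f : 'M[R]_(m, n) -> 'M[R]_(m, n)) :
  (forall x, `|x| <= N x) -> (forall x, N x <= c * `|x|) ->
  0 <= c -> 0 <= q -> q < 1 -> closed U -> (U !=set0)%classic ->
  (forall x, U x -> U (f x)) ->
  (forall x y, U x -> U y -> N (f x - f y) <= q * N (x - y)) ->
  exists2 p, U p & f p = p.
Proof.
move=> leN Nle c0 q0 q1 Ucl Une fU fq.
(* Passing from the sup norm to [N] and back costs the factor [c] only once, so the [k]-th iterate
   has sup-norm rate [q ^+ k * c]. *)
have [k qk] : exists k, q ^+ k * c < 1.
  have q1' : `|q| < 1 by rewrite ger0_norm.
  have : (geometric c q @ \oo --> 0)%classic := cvg_geometric c q1'.
  move=> /cvgrPdist_lt /(_ 1 ltr01) [k _ /(_ k (leqnn k))] /=.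
  rewrite sub0r normrN => /(le_lt_trans (ler_norm _)).
  by exists k; rewrite mulrC.
have iU i x : U x -> U (iter i f x) by move=> Ux; elim: i => //= i; apply: fU.
have iN i x y : U x -> U y -> N (iter i f x - iter i f y) <= q ^+ i * N (x - y).
  move=> Ux Uy; elim: i => [|i ih]; first by rewrite mul1r.
  rewrite /= (le_trans (fq _ _ (iU _ _ Ux) (iU _ _ Uy)))//.
  by rewrite exprS -mulrA ler_wpM2l.
pose g := mkfun_fun (fun x Ux => iU k x Ux : U (iter k f x)).
have gc : is_contraction g.
  have qk0 : 0 <= q ^+ k * c by rewrite mulr_ge0 ?exprn_ge0.
  exists (NngNum qk0); split=> //= -[x y] /= [Ux Uy].
  rewrite (le_trans (leN _))// (le_trans (iN _ _ _ Ux Uy))// -mulrA.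
  by rewrite ler_wpM2l ?exprn_ge0.
have [p Up gp] := banach_fixed_point gc Ucl Une.
exists p => //; apply: (contraction_fixpoint_unique gc) => //; first exact: fU.
have {}gp : p = iter k f p := gp.
by rewrite {1}gp -iterS iterSr.
Qed.
End FixedPoint.

(** * Operator norm *)

Section OpNormTheory.
Variable R : realType.

Lemma l2norm_ge0 m (x : 'cV[R]_m) : 0 <= l2norm x.
Proof. exact: sqrtr_ge0. Qed.

Lemma sqr_l2norm m (x : 'cV[R]_m) : l2norm x ^+ 2 = \sum_i x i 0 ^+ 2.
Proof. by rewrite sqr_sqrtr// sumr_ge0// => i _; rewrite sqr_ge0. Qed.

Lemma l2norm_eq0 m (x : 'cV[R]_m) : l2norm x = 0 -> x = 0.
Proof.
move=> x0; apply/matrixP => i j; rewrite ord1 mxE; apply/eqP.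
by rewrite -normr_le0 -x0 ler_norm_l2norm.
Qed.

Lemma l2normZ m (a : R) (x : 'cV[R]_m) : l2norm (a *: x) = `|a| * l2norm x.
Proof.
rewrite /l2norm -sqrtr_sqr -sqrtrM ?sqr_ge0// mulr_sumr; congr Num.sqrt.
by apply: eq_bigr => i _; rewrite mxE exprMn.
Qed.

(** With A, B, C as named below, the sum of the squares of a_i B - b_i C is B (AB - C^2). If B > 0,
    divide by B; if B = 0, all b_i vanish. *)
Lemma cauchy_schwarz_sum (I : finType) (a b : I -> R) :
  (\sum_i a i * b i) ^+ 2 <= (\sum_i a i ^+ 2) * (\sum_i b i ^+ 2).
Proof.
set C := \sum_i _ * _; set A := \sum_i a i ^+ 2; set B := \sum_i b i ^+ 2.
have B0 : 0 <= B by apply: sumr_ge0 => i _; exact: sqr_ge0.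
have : 0 <= \sum_i (a i * B - b i * C) ^+ 2.
  by apply: sumr_ge0 => i _; exact: sqr_ge0.
have -> : \sum_i (a i * B - b i * C) ^+ 2 = B * (A * B - C ^+ 2).
  transitivity (\sum_i (a i ^+ 2 * B ^+ 2 + b i ^+ 2 * C ^+ 2
      - a i * b i * (2 * B * C))); first by apply: eq_bigr => i _; ring.
  by rewrite sumrB big_split/= -!mulr_suml -/A -/B -/C; ring.
have [Bpos|] := ltP 0 B; first by rewrite pmulr_rge0// subr_ge0.
move=> Ble _; have {B0 Ble}/eqP : B = 0 by apply/eqP; rewrite eq_le Ble.
rewrite psumr_eq0 => [/allP b0|i _]; last exact: sqr_ge0.
rewrite /C big1 ?expr0n/= ?mulr_ge0 ?sumr_ge0// => i _; rewrite ?sqr_ge0//.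
by have := b0 i (mem_index_enum i); rewrite sqrf_eq0 => /eqP->; rewrite mulr0.
Qed.

Lemma ler_norm_dot m (x y : 'cV[R]_m) :
  `|(x^T *m y) 0 0| <= l2norm x * l2norm y.
Proof.
rewrite -ler_sqr ?nnegrE ?mulr_ge0 ?l2norm_ge0// exprMn !sqr_l2norm.
rewrite real_normK ?num_real// mxE.
rewrite (le_trans _ (cauchy_schwarz_sum (x ^~ 0) (y ^~ 0)))//.
by under eq_bigr do rewrite mxE.
Qed.

Lemma l2normD m (x y : 'cV[R]_m) : l2norm (x + y) <= l2norm x + l2norm y.
Proof.
rewrite -ler_sqr ?nnegrE ?addr_ge0 ?l2norm_ge0// sqrrD !sqr_l2norm.
have -> : \sum_i (x + y) i 0 ^+ 2
    = \sum_i x i 0 ^+ 2 + (x^T *m y) 0 0 *+ 2 + \sum_i y i 0 ^+ 2.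
  rewrite mxE -sumrMnl -!big_split/=; apply: eq_bigr => i _; rewrite !mxE; ring.
by rewrite lerD2r lerD2l lerMn2r (le_trans (ler_norm _))// ler_norm_dot.
Qed.

Lemma op_norm_ge0 m n (A : 'M[R]_(m, n)) : 0 <= op_norm A.
Proof.
apply: ub_le_sup; first by case: (op_norm_has_sup A).
by exists 0; rewrite /= ?mulmx0 l2norm0.
Qed.

Lemma l2norm_mulmx m n (A : 'M[R]_(m, n)) (x : 'cV[R]_n) :
  l2norm (A *m x) <= op_norm A * l2norm x.
Proof.
have [/l2norm_eq0->|x0] := eqVneq (l2norm x) 0.
  by rewrite mulmx0 !l2norm0 mulr0.
have xpos : 0 < l2norm x by rewrite lt_def x0 l2norm_ge0.
rewrite -ler_pdivrMr//; apply: ub_le_sup; first by case: (op_norm_has_sup A).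
exists ((l2norm x)^-1 *: x) => /=.
  by rewrite l2normZ ger0_norm ?invr_ge0 ?l2norm_ge0// mulVf.
by rewrite -scalemxAr l2normZ ger0_norm ?invr_ge0 ?l2norm_ge0// mulrC.
Qed.

Lemma op_norm_le m n (A : 'M[R]_(m, n)) (c : R) : 0 <= c ->
  (forall x, l2norm (A *m x) <= c * l2norm x) -> op_norm A <= c.
Proof.
move=> c0 Ac; apply: ge_sup; first by case: (op_norm_has_sup A).
by move=> _ [x /= x1 <-]; rewrite (le_trans (Ac x))// ler_piMr.
Qed.

Lemma op_norm0 m n : op_norm (0 : 'M[R]_(m, n)) = 0.
Proof. by apply/eqP; rewrite eq_le op_norm_ge0 andbT; apply/op_norm_le0. Qed.

Lemma op_normZ m n (a : R) (A : 'M[R]_(m, n)) :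
  op_norm (a *: A) = `|a| * op_norm A.
Proof.
(* One inequality suffices: applied to [a^-1] and [a *: A] it yields the converse. *)
have le b B : op_norm (b *: B : 'M[R]_(m, n)) <= `|b| * op_norm B.
  apply: op_norm_le => [|x]; first by rewrite mulr_ge0 ?op_norm_ge0.
  by rewrite -scalemxAl l2normZ -mulrA ler_wpM2l// l2norm_mulmx.
apply/eqP; rewrite eq_le le/=.
have [->|a0] := eqVneq a 0; first by rewrite normr0 mul0r op_norm_ge0.
rewrite -ler_pdivlMl ?normr_gt0// -normfV.
by rewrite (le_trans _ (le _ _))// scalerK.
Qed.

Lemma op_normN m n (A : 'M[R]_(m, n)) : op_norm (- A) = op_norm A.
Proof. by rewrite -scaleN1r op_normZ normrN1 mul1r. Qed.

Lemma op_normD m n (A B : 'M[R]_(m, n)) :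
  op_norm (A + B) <= op_norm A + op_norm B.
Proof.
apply: op_norm_le => [|x]; first by rewrite addr_ge0 ?op_norm_ge0.
rewrite mulmxDl mulrDl (le_trans (l2normD _ _))//.
by rewrite lerD ?l2norm_mulmx.
Qed.

Lemma op_normB m n (A B : 'M[R]_(m, n)) :
  op_norm (A - B) <= op_norm A + op_norm B.
Proof. by rewrite -(op_normN B) op_normD. Qed.

Lemma op_normM m n p (A : 'M[R]_(m, n)) (B : 'M[R]_(n, p)) :
  op_norm (A *m B) <= op_norm A * op_norm B.
Proof.
apply: op_norm_le => [|x]; first by rewrite mulr_ge0 ?op_norm_ge0.
rewrite -mulmxA (le_trans (l2norm_mulmx _ _))// -mulrA.
by rewrite ler_wpM2l ?op_norm_ge0 ?l2norm_mulmx.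
Qed.

Lemma ler_norm_op_norm m n (A : 'M[R]_(m, n)) i j : `|A i j| <= op_norm A.
Proof.
have -> : A i j = (A *m (delta_mx j 0 : 'cV_n)) i 0 by rewrite -colE mxE.
apply: le_trans (ler_norm_l2norm _ i) _; apply: le_trans (l2norm_mulmx _ _) _.
rewrite ler_piMr ?op_norm_ge0//.
rewrite /l2norm (bigD1 j)//= big1 ?mxE ?eqxx ?expr1n ?addr0 ?sqrtr1// => k kj.
by rewrite mxE (negbTE kj) expr0n.
Qed.

Lemma mx_norm_le_op_norm m n (A : 'M[R]_(m, n)) : `|A| <= op_norm A.
Proof.
rewrite [leLHS]mx_normrE; apply/bigmax_leP; split; first exact: op_norm_ge0.
by move=> ij _; exact: ler_norm_op_norm.
Qed.

Lemma ler_norm_mx_norm m n (A : 'M[R]_(m, n)) i j : `|A i j| <= `|A|.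
Proof.
by rewrite [leRHS]mx_normrE; apply/bigmax_geP; right; exists (i, j).
Qed.

(** This dimension-dependent constant serves only topological purposes, namely closedness and the
    existence of fixed points; it enters no quantitative bound. *)
Lemma op_norm_le_mx_norm m n : exists2 c : R, 0 <= c &
  forall A : 'M[R]_(m, n), op_norm A <= c * `|A|.
Proof.
exists (\sum_i \sum_j op_norm (delta_mx i j : 'M[R]_(m, n))) => [|A].
  by rewrite !sumr_ge0// => i _; rewrite sumr_ge0// => j _; exact: op_norm_ge0.
rewrite {1}(matrix_sum_delta A) mulr_suml.
elim/big_ind2: _ => [|X x Y y hX hY|i _]; first by rewrite op_norm0.
  by rewrite (le_trans (op_normD _ _))// lerD.
rewrite mulr_suml; elim/big_ind2: _ => [|X x Y y hX hY|j _].
- by rewrite op_norm0.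
- by rewrite (le_trans (op_normD _ _))// lerD.
by rewrite op_normZ mulrC ler_wpM2l ?op_norm_ge0 ?ler_norm_mx_norm.
Qed.

Lemma ler_norm_quad_form n (A : 'M[R]_n) (x : 'cV[R]_n) :
  `|(x^T *m A *m x) 0 0| <= op_norm A * l2norm x ^+ 2.
Proof.
rewrite -mulmxA (le_trans (ler_norm_dot _ _))// expr2 mulrCA.
by rewrite ler_wpM2l ?l2norm_ge0 ?l2norm_mulmx.
Qed.

(** * Matrices close to the identity *)

Section NearIdentity.
Context {n : nat} {A : 'M[R]_n} {v : R}.
Hypotheses (Av : op_norm (A - 1%:M) <= v) (v1 : v < 1).

Lemma near1_l2norm (x : 'cV[R]_n) : (1 - v) * l2norm x <= l2norm (A *m x).
Proof.
have -> : (1 - v) * l2norm x = l2norm x - v * l2norm x by ring.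
rewrite lerBlDr -[leLHS](_ : l2norm (A *m x - (A - 1%:M) *m x) = _); last first.
  by rewrite mulmxBl mul1mx opprB addrC subrK.
rewrite (le_trans (l2normD _ _))// lerD2l -scaleN1r l2normZ normrN1 mul1r.
by rewrite (le_trans (l2norm_mulmx _ _))// ler_wpM2r ?l2norm_ge0.
Qed.

Lemma near1_unitmx : A \in unitmx.
Proof.
(* [kermx] collects row vectors, so the column kernel of [A] is read off from its transpose;
   [near1_l2norm] makes it trivial. *)
rewrite -unitmx_tr -row_free_unit -kermx_eq0; apply/eqP/row_matrixP => i.
rewrite row0; set x := row i _.
have xA : x *m A^T = 0 by apply/sub_kermxP; exact: row_sub.
apply: trmx_inj; rewrite trmx0; apply: l2norm_eq0; apply/eqP.
rewrite eq_le l2norm_ge0 andbT -(@pmulr_rle0 _ (1 - v)) ?subr_gt0//.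
rewrite (le_trans (near1_l2norm _))//.
by rewrite -[A]trmxK -trmx_mul xA trmx0 l2norm0.
Qed.

Lemma near1_invmx : op_norm (invmx A) <= (1 - v)^-1.
Proof.
apply: op_norm_le => [|x]; first by rewrite invr_ge0 subr_ge0 ltW.
rewrite ler_pdivlMl ?subr_gt0// (le_trans (near1_l2norm _))//.
by rewrite mulKVmx ?near1_unitmx.
Qed.

Lemma near1_invmx_sub1 : op_norm (invmx A - 1%:M) <= v / (1 - v).
Proof.
have -> : invmx A - 1%:M = - ((A - 1%:M) *m invmx A).
  by rewrite mulmxBl mul1mx mulmxV ?near1_unitmx// opprB.
rewrite op_normN (le_trans (op_normM _ _))//.
by rewrite ler_pM ?op_norm_ge0 ?near1_invmx.
Qed.

End NearIdentity.
End OpNormTheory.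

(** * Square roots and balancing weights *)

(** The left side is the Lipschitz constant found for the map [G] below, with [e] = eps/lam. It is
    at most 1 - lam + 84 e, and 84 e <= lam / 2. *)
Lemma contraction_factor_le (R : realType) (e lam : R) :
  0 <= e -> 800%:R * e <= lam -> lam <= 1 ->
  36%:R * e + (1 + 8%:R * e) * (1 + e) * (1 + 18%:R * e) ^+ 2 * (1 - lam)
    <= 1 - lam / 2%:R.
Proof.
move=> e0 el l1.
have e1 : 800%:R * e <= 1 by lra.
have e2 : 800%:R * e ^+ 2 <= e 
  by rewrite expr2 mulrA; exact: ler_piMl.
have h1 : (1 + 8%:R * e) * (1 + e) <= 1 + 10%:R * e.
  by have : 0 <= e ^+ 2 := sqr_ge0 _; lra.
have h2 : (1 + 18%:R * e) ^+ 2 <= 1 + 37%:R * e by lra.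
have p1 : 0 <= (1 + 8%:R * e) * (1 + e) by rewrite mulr_ge0//; lra.
have k : (1 + 8%:R * e) * (1 + e) * (1 + 18%:R * e) ^+ 2 <= 1 + 48%:R * e.
  by rewrite (le_trans (ler_pM _ _ h1 h2)) ?sqr_ge0//; lra.
have l0 : 0 <= 1 - lam by lra.
rewrite (le_trans (lerD (lexx _) (ler_wpM2r l0 k)))//.
have : 0 <= e * lam by rewrite mulr_ge0//; lra.
lra.
Qed.

Section Scaling.
Variable R : realType.

Lemma closed_op_norm_ball m n (r : R) :
  closed [set Y : 'M[R]_(m, n) | op_norm Y <= r]%classic.
Proof.
have [c _ cP] := op_norm_le_mx_norm R m n.
apply: (@closed_lipschitz_le _ _ _ c) => X Y.
rewrite lerBlDr (le_trans _ (lerD (cP _) (lexx _)))//.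
by rewrite -[X in leLHS](subrK Y) op_normD.
Qed.

(** Symmetry is a sublevel condition at 0 for a function that is 2-Lipschitz, because transposition
    does not increase the largest entry. *)
Lemma closed_symmetric n : closed [set Y : 'M[R]_n | Y^T = Y]%classic.
Proof.
have -> : [set Y : 'M[R]_n | Y^T = Y]%classic
    = [set Y : 'M[R]_n | `|Y^T - Y| <= 0]%classic.
  apply/seteqP; split=> Y /=; first by move->; rewrite subrr normr0.
  by rewrite normr_le0 subr_eq0 => /eqP.
apply: (@closed_lipschitz_le _ _ _ 2) => X Y.
have trn (Z : 'M[R]_n) : `|Z^T| <= `|Z|.
  rewrite [leLHS]mx_normrE; apply/bigmax_leP; split=> [//|ij _].
  by rewrite mxE ler_norm_mx_norm.
rewrite (le_trans (lerB_dist _ _))//.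
have -> : X^T - X - (Y^T - Y) = (X - Y)^T - (X - Y).
  by rewrite [(X - Y)^T]linearB/= !opprD !opprK addrACA.
by rewrite (le_trans (ler_normB _ _))// mulrC mulr_natr mulr2n lerD2r.
Qed.

(* [K = 1 + Y] where [Y] solves [Y = (M - 1 - Y^2) / 2]. *)
Lemma near1_symmetric_sqrt n (M : 'M[R]_n) (v : R) :
  M^T = M -> op_norm (M - 1%:M) <= v -> v < 1 ->
  exists K : 'M[R]_n, [/\ K^T = K, K *m K = M & op_norm (K - 1%:M) <= v].
Proof.
move=> Msym Mv v1; have v0 : 0 <= v := le_trans (op_norm_ge0 _) Mv.
have [c c0 cP] := op_norm_le_mx_norm R n n.
pose f (Y : 'M[R]_n) := 2^-1 *: (M - 1%:M - Y *m Y).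
(* Keeping symmetry in the invariant set makes the fixed point symmetric. The ball is stable since
   (v + v^2) / 2 <= v. *)
pose U := ([set Y : 'M[R]_n | op_norm Y <= v] `&`
           [set Y : 'M[R]_n | Y^T = Y])%classic.
have nrm2 : `|2^-1 : R| = 2^-1 by rewrite ger0_norm ?invr_ge0.
have [||||Y [Yv Ysym] fY] :=
    @equiv_norm_fixed_point R n n (@op_norm R n n) c v U f
      (@mx_norm_le_op_norm _ _ _) cP c0 v0 v1.
- by apply: closedI; [exact: closed_op_norm_ball|exact: closed_symmetric].
- by exists 0; split=> /=; rewrite ?op_norm0 ?trmx0.
- move=> Y [/= Yv Ysym]; split=> /=.
    rewrite /f op_normZ nrm2.
    rewrite (le_trans (ler_wpM2l _ (op_normB _ _))) ?invr_ge0//.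
    have YY : op_norm (Y *m Y) <= v * v.
      by rewrite (le_trans (op_normM _ _))// ler_pM ?op_norm_ge0.
    rewrite (le_trans (ler_wpM2l _ (lerD Mv YY))) ?invr_ge0//; nra.
  by rewrite /f linearZ/= !linearB/= trmx_mul Ysym Msym trmx1.
- move=> X Y [/= Xv _] [/= Yv _].
  (* This form of X^2 - Y^2 needs no commutation; each summand contributes v / 2, so the contraction
     rate is [v]. *)
  have -> : f X - f Y = - 2^-1 *: (X *m (X - Y) + (X - Y) *m Y).
    rewrite /f -scalerBr scaleNr -scalerN; congr (_ *: _).
    by rewrite mulmxBr mulmxBl subrKA [X in X - _]addrC addrKA opprD.
  rewrite op_normZ normrN nrm2.
  rewrite (le_trans (ler_wpM2l _ (op_normD _ _))) ?invr_ge0//.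
  have h1 : op_norm (X *m (X - Y)) <= v * op_norm (X - Y).
    by rewrite (le_trans (op_normM _ _))// ler_wpM2r ?op_norm_ge0.
  have h2 : op_norm ((X - Y) *m Y) <= v * op_norm (X - Y).
    by rewrite (le_trans (op_normM _ _))// mulrC ler_wpM2r ?op_norm_ge0.
  by rewrite (le_trans (ler_wpM2l _ (lerD h1 h2))) ?invr_ge0//; lra.
exists (1%:M + Y); split; first by rewrite linearD/= trmx1 Ysym.
- rewrite mulmxDl mul1mx mulmxDr mulmx1.
  have e : Y + Y + Y *m Y = M - 1%:M.
    rewrite -mulr2n -{1}fY /f -scaler_nat scalerA divff ?pnatr_eq0//.
    by rewrite scale1r subrK.
  by rewrite -addrA [Y + _]addrA e addrC subrK.
- by rewrite [1%:M + Y]addrC addrK.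
Qed.

(** * Balancing weights as a fixed point *)

Section Weights.
(* In the application [a = d / s(V)] and [b = n / s(V)]. *)
Variables (d n : nat) (V : 'M[R]_(d, n)) (a b eps lam : R).
Hypotheses (a0 : 0 < a) (b0 : 0 <= b) (eps0 : 0 <= eps).
Hypotheses (lam0 : 0 < lam) (lam1 : lam <= 1).
Hypothesis eps_lam : 800%:R * eps <= lam ^+ 2.
Hypothesis bd_an : b * d%:R = a * n%:R.

Let P (z : 'cV[R]_n) : 'M[R]_d := a *: (V *m diag_mx z^T *m V^T).
(** The quantity tau_j(z) is [tau (invmx (P z)) j]; taking the inverse as the argument makes [tau]
    linear. *)
Let tau (X : 'M[R]_d) (j : 'I_n) : R := b * (V^T *m X *m V) j j.

(** The three hypotheses are the bounds on [errE V] and [errF V] divided by s(V), and expansion in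
    homogeneous form. *)
Hypothesis P1 : op_norm (P (const_mx 1) - 1%:M) <= eps.
Hypothesis bV : forall j, `|b * l2norm (col j V) ^+ 2 - 1| <= eps.
Hypothesis expansion : forall h : 'cV[R]_n, \sum_j h j 0 = 0 ->
  op_norm (P h) <= (1 - lam) * `|h|.

Let PB z w : P (z - w) = P z - P w.
Proof. by rewrite /P -scalerBr -mulmxBl -mulmxBr !raddfB. Qed.

Let tauB X Y j : tau (X - Y) j = tau X j - tau Y j.
Proof.
by rewrite /tau mulmxBr mulmxBl [X in b * X]mxE [X in b * (_ + X)]mxE mulrBr.
Qed.

Let quadE (X : 'M[R]_d) j :
  (V^T *m X *m V) j j = ((col j V)^T *m X *m col j V) 0 0.
Proof.
rewrite !mxE; apply: eq_bigr => i _; rewrite !mxE; congr (_ * _).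
by apply: eq_bigr => k _; rewrite !mxE.
Qed.

Let tau1 j : `|1 - tau 1%:M j| <= eps.
Proof.
rewrite distrC; have := bV j; congr (`|_ * _ - _| <= _).
by rewrite quadE mulmx1 sqr_l2norm mxE; apply: eq_bigr => i _; rewrite !mxE.
Qed.

(** The quadratic form at v_j is bounded by the operator norm times |v_j|^2, and [bV] gives b
    |v_j|^2 <= 1 + eps. *)
Let tau_le X j : `|tau X j| <= (1 + eps) * op_norm X.
Proof.
have := ler_norm_quad_form X (col j V).
rewrite /tau quadE normrM (ger0_norm b0).
move=> /(ler_wpM2l b0) /le_trans; apply.
rewrite mulrCA mulrC ler_wpM2r ?op_norm_ge0//.
by have := bV j; rewrite ler_norml => /andP[_]; lra.
Qed.

(** Applied twice: with [v] = eps at the all-ones weight, and with [v] = 9 e on the whole ball. The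
    bound is eps + (1 + eps) 2 v <= 4 v. *)
Let tau_invmx (X : 'M[R]_d) (v : R) j :
  op_norm (X - 1%:M) <= v -> eps <= v -> 80%:R * v <= 1 ->
  `|1 - tau (invmx X) j| <= 4%:R * v.
Proof.
move=> Xv ev v1.
have -> : 1 - tau (invmx X) j = (1 - tau 1%:M j) - tau (invmx X - 1%:M) j.
  by rewrite tauB; ring.
have v1' : v < 1 by lra.
have v0 : 0 <= v := le_trans eps0 ev.
rewrite (le_trans (ler_normB _ _))//.
rewrite (le_trans (lerD (tau1 j) (tau_le _ _)))//.
have h : op_norm (invmx X - 1%:M) <= 2%:R * v.
  rewrite (le_trans (near1_invmx_sub1 Xv v1'))// mulrC ler_wpM2r//.
  by rewrite -[2%:R]invrK lef_pV2 ?posrE; lra.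
have e1 : 0 <= 1 + eps by rewrite addr_ge0.
rewrite (le_trans (lerD (lexx _) (ler_wpM2l e1 h)))//; nra.
Qed.

Let e := eps / lam.
Let epsE : eps = e * lam.
Proof. by rewrite /e divfK// gt_eqF. Qed.
Let e0 : 0 <= e.
Proof. by rewrite divr_ge0// ltW. Qed.
Let e_lam : 800%:R * e <= lam.
Proof. by rewrite /e mulrA ler_pdivrMr// -expr2. Qed.
Let e_1 : 800%:R * e <= 1.
Proof. exact: le_trans e_lam lam1. Qed.
Let eps_e : eps <= e.
Proof. by rewrite epsE ler_piMr. Qed.

Let one : 'cV[R]_n := const_mx 1.
(** The equation for the sum is written as a sublevel condition so that [closed_lipschitz_le]
    applies. Differences of elements have zero sum, as expansion requires. *)
Let U : set 'cV[R]_n := ([set z : 'cV[R]_n | (`|z - one| <= 8%:R * e)%R] `&`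
  [set z : 'cV[R]_n | (`|\sum_j z j 0 - n%:R| <= 0)%R])%classic.
Let G (z : 'cV[R]_n) : 'cV[R]_n :=
  \col_j (z j 0 + 1 - z j 0 * tau (invmx (P z)) j).

Let U_sum z : U z -> \sum_j z j 0 = n%:R.
Proof. by case=> _ /=; rewrite normr_le0 subr_eq0 => /eqP. Qed.

Let U_sumB z w : U z -> U w -> \sum_j (z - w) j 0 = 0.
Proof.
move=> /U_sum Uz /U_sum Uw.
under eq_bigr do rewrite !mxE.
by rewrite sumrB Uz Uw subrr.
Qed.

Let U_one : U one.
Proof.
split=> /=; first by rewrite subrr normr0 mulr_ge0.
under eq_bigr do rewrite mxE.
by rewrite sumr_const card_ord subrr normr0.
Qed.

(** Expansion applied to [z - one] gives (1 - lam) 8 e, and [P1] adds eps <= e. *)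
Let U_P z : U z -> op_norm (P z - 1%:M) <= 9%:R * e.
Proof.
move=> Uz; have -> : P z - 1%:M = P (z - one) + (P one - 1%:M).
  by rewrite PB subrKA.
rewrite (le_trans (op_normD _ _))//.
rewrite (le_trans (lerD (expansion (U_sumB Uz U_one)) P1))//.
have [/= Uz1 _] := Uz; have := normr_ge0 (z - one).
by move: `|z - one| Uz1 => t; have := eps_e; have := lam0; nra.
Qed.

Let U_closed : closed U.
Proof.
apply: closedI.
  apply: (@closed_lipschitz_le _ _ _ 1) => x y.
  by rewrite mul1r (le_trans (lerB_dist _ _))// opprB addrA subrK.
apply: (@closed_lipschitz_le _ _ _ n%:R) => x y.
rewrite (le_trans (lerB_dist _ _))// opprB addrA subrK -sumrB.
rewrite (le_trans (ler_norm_sum _ _ _))//.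
have -> : n%:R * `|x - y| = \sum_(j < n) `|x - y|.
  by rewrite sumr_const card_ord mulr_natl.
apply: ler_sum => j _.
by have := ler_norm_mx_norm (x - y) j 0; rewrite !mxE.
Qed.

Let U_G z : U z -> \sum_j G z j 0 = n%:R.
Proof.
move=> Uz; have uP : P z \in unitmx.
  by apply: near1_unitmx (U_P Uz) _; have := e_1; lra.
under eq_bigr do rewrite mxE.
rewrite sumrB big_split/= sumr_const card_ord (U_sum Uz).
(* By cyclicity of the trace the sum is b tr(P^-1 a^-1 P) = b d / a, which is n by [bd_an]. *)
suff -> : \sum_j z j 0 * tau (invmx (P z)) j = n%:R by rewrite addrK.
transitivity (b * \tr (invmx (P z) *m (V *m diag_mx z^T *m V^T))).
  rewrite !mulmxA mxtrace_mulC !mulmxA /mxtrace mulr_sumr.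
  apply: eq_bigr => j _.
  by rewrite mul_mx_diag [X in _ = b * X]mxE [z^T _ _]mxE /tau; ring.
have -> : V *m diag_mx z^T *m V^T = a^-1 *: P z.
  by rewrite /P scalerA mulVf ?scale1r// gt_eqF.
rewrite -scalemxAr mulVmx// mxtraceZ mxtrace1 mulrCA bd_an mulrA mulVf ?mul1r//.
by rewrite gt_eqF.
Qed.

Let e9_lt1 : 9%:R * e < 1.
Proof. by have := e0; have := e_1; lra. Qed.

Let invP_le z : U z -> op_norm (invmx (P z)) <= 1 + 18%:R * e.
Proof.
move=> Uz; apply: le_trans (near1_invmx (U_P Uz) e9_lt1) _.
have E0 := e0; have E1 := e_1.
rewrite -[leRHS]invrK lef_pV2 ?posrE ?invr_gt0; [|lra|lra].
by rewrite -[leLHS]mul1r ler_pdivrMr; [nra|lra].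
Qed.

Let tau_invP z j : U z -> `|1 - tau (invmx (P z)) j| <= 36%:R * e.
Proof.
move=> Uz; rewrite (_ : 36%:R * e = 4%:R * (9%:R * e)); last by ring.
apply: tau_invmx; first exact: U_P.
  by have := eps_e; have := e0; lra.
by have := e0; have := e_1; lra.
Qed.

Let U_entry z j : U z -> `|z j 0| <= 1 + 8%:R * e.
Proof.
case=> /= Uz1 _; have := le_trans (ler_norm_mx_norm (z - one) j 0) Uz1.
by rewrite !mxE !ler_norml; have := e0; lra.
Qed.

(** The resolvent identity puts [P (z - w)] between two inverses of norm at most 1 + 18 e; this is
    where expansion yields the factor 1 - lam. *)
Let invP_sub z w : U z -> U w ->
  op_norm (invmx (P w) - invmx (P z))
    <= (1 + 18%:R * e) ^+ 2 * ((1 - lam) * `|z - w|).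
Proof.
move=> Uz Uw.
have uz := near1_unitmx (U_P Uz) e9_lt1.
have uw := near1_unitmx (U_P Uw) e9_lt1.
have -> : invmx (P w) - invmx (P z) = invmx (P z) *m P (z - w) *m invmx (P w).
  by rewrite PB mulmxBr mulVmx// mulmxBl mul1mx -mulmxA mulmxV// mulmx1.
rewrite expr2 mulrAC; apply: le_trans (op_normM _ _) _.
apply: ler_pM; [exact: op_norm_ge0|exact: op_norm_ge0| |exact: invP_le].
apply: le_trans (op_normM _ _) _.
apply: ler_pM; [exact: op_norm_ge0|exact: op_norm_ge0|exact: invP_le|].
exact: expansion (U_sumB Uz Uw).
Qed.

Let G_lip z w : U z -> U w -> `|G z - G w| <= (1 - lam / 2%:R) * `|z - w|.
Proof.
move=> Uz Uw; set h := z - w.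
suff entry j : `|(G z - G w) j 0| <= (1 - lam / 2%:R) * `|h|.
  rewrite [leLHS]mx_normrE; apply/bigmax_leP; split=> [|[j k] _ /=].
    apply: mulr_ge0 (normr_ge0 _).
    by have := lam0; have := lam1; lra.
  by rewrite ord1; exact: entry.
(* The first term is small because tau is within 36 e of 1; the second is the main term, controlled
   by expansion. *)
have -> : (G z - G w) j 0 = h j 0 * (1 - tau (invmx (P w)) j)
    + z j 0 * tau (invmx (P w) - invmx (P z)) j.
  by rewrite tauB !mxE; ring.
have t2 : `|tau (invmx (P w) - invmx (P z)) j|
    <= (1 + e) * ((1 + 18%:R * e) ^+ 2 * ((1 - lam) * `|h|)).
  apply: le_trans (tau_le _ _) _.
  apply: ler_pM; [exact: addr_ge0|exact: op_norm_ge0| |exact: invP_sub].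
  by rewrite lerD2l.
apply: le_trans (ler_normD _ _) _.
rewrite (normrM (h j 0)) (normrM (z j 0)).
apply: le_trans (lerD (ler_pM (normr_ge0 _) (normr_ge0 _)
    (ler_norm_mx_norm h j 0) (tau_invP j Uw))
  (ler_pM (normr_ge0 _) (normr_ge0 _) (U_entry j Uz) t2)) _.
have -> : `|h| * (36%:R * e) + (1 + 8%:R * e) *
    ((1 + e) * ((1 + 18%:R * e) ^+ 2 * ((1 - lam) * `|h|)))
  = (36%:R * e + (1 + 8%:R * e) * (1 + e) * (1 + 18%:R * e) ^+ 2 * (1 - lam))
    * `|h| by ring.
apply: ler_wpM2r (normr_ge0 _) _ _ _.
exact: contraction_factor_le e0 e_lam lam1.
Qed.

Lemma balancing_weights : exists z : 'cV[R]_n,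
  [/\ `|z - const_mx 1| <= 8%:R * (eps / lam),
      op_norm (P z - 1%:M) <= 9%:R * (eps / lam) &
      forall j, z j 0 * (b * (V^T *m invmx (P z) *m V) j j) = 1].
Proof.
have L0 := lam0; have L1 := lam1.
have q0 : 0 <= 1 - lam / 2%:R by lra.
have q1 : 1 - lam / 2%:R < 1 by lra.
have le1 (x : 'cV[R]_n) : `|x| <= 1 * `|x| by rewrite mul1r.
have [z Uz|z Uz Gz] := equiv_norm_fixed_point (fun=> lexx _) le1 ler01 q0 q1
    U_closed (ex_intro _ one U_one : U !=set0)%classic _ G_lip.
- split=> /=; last by rewrite U_G// subrr normr0.
  (* The radius 8 e is chosen so that (1 - lam / 2) 8 e + 4 eps = 8 e, using eps = e lam. *)
  have -> : G z - one = (G z - G one) + (G one - one) by rewrite subrKA.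
  rewrite (le_trans (ler_normD _ _))//.
  have G1 : `|G one - one| <= 4%:R * eps.
    rewrite [leLHS]mx_normrE; apply/bigmax_leP; split=> [|[j k] _ /=].
      by rewrite mulr_ge0.
    rewrite ord1 (_ : _ j 0 = 1 - tau (invmx (P one)) j); last first.
      by rewrite !mxE; ring.
    by apply: tau_invmx => //; have := eps_e; have := e_1; lra.
  rewrite (le_trans (lerD (G_lip Uz U_one) G1))// epsE.
  have [/= Uz1 _] := Uz.
  rewrite (le_trans (lerD (ler_wpM2l q0 Uz1) (lexx _)))//.
  by nra.
exists z; split; [by case: Uz|exact: U_P|move=> j].
by have /matrixP/(_ j 0) := Gz; rewrite mxE /tau; lra.
Qed.
End Weights.

(** * From balancing weights to a scaling solution *)

Lemma frame_sizeE d n (V : 'M[R]_(d, n)) :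
  frame_size V = \sum_i \sum_j V i j ^+ 2.
Proof.
rewrite /frame_size sqr_sqrtr// sumr_ge0// => i _; rewrite sumr_ge0// => j _.
exact: sqr_ge0.
Qed.

Lemma mxtrace_gram d n (V : 'M[R]_(d, n)) : \tr (V *m V^T) = frame_size V.
Proof.
rewrite frame_sizeE; apply: eq_bigr => i _; rewrite mxE.
by apply: eq_bigr => j _; rewrite mxE expr2.
Qed.

Lemma sqr_l2norm_col d n (V : 'M[R]_(d, n)) j :
  l2norm (col j V) ^+ 2 = (V^T *m V) j j.
Proof.
by rewrite sqr_l2norm mxE; apply: eq_bigr => i _; rewrite !mxE expr2.
Qed.

Lemma weighted_gramE d n (V : 'M[R]_(d, n)) (h : 'cV[R]_n) :
  V *m diag_mx h^T *m V^T = \sum_j h j 0 *: (col j V *m (col j V)^T).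
Proof.
apply/matrixP => i k; rewrite mul_mx_diag mxE summxE; apply: eq_bigr => j _.
by rewrite !mxE big_ord1 !mxE; ring.
Qed.

(** Rescaling a nonzero [h] to sup norm 1 makes the definition applicable. *)
Lemma infty_expansion_le d n (V : 'M[R]_(d, n)) (lam : R) (h : 'cV[R]_n) :
  infty_expansion lam V -> \sum_j h j 0 = 0 ->
  op_norm (V *m diag_mx h^T *m V^T) <= `|h| * (frame_size V * (1 - lam) / d%:R).
Proof.
move=> Vexp h0; have [->|hn] := eqVneq h 0.
  by rewrite trmx0 raddf0 mulmx0 mul0mx op_norm0 normr0 mul0r.
have hpos : 0 < `|h| by rewrite normr_gt0.
rewrite -ler_pdivrMl// -[X in X * _]ger0_norm ?invr_ge0// -op_normZ.
have := Vexp (`|h|^-1 *: h); rewrite weighted_gramE scaler_sumr.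
under eq_bigr do rewrite mxE.
rewrite -mulr_sumr h0 mulr0 => /(_ erefl).
have h1 : mx_norm (`|h|^-1 *: h) <= 1.
  change (`| `|h|^-1 *: h | <= 1).
  by rewrite mx_normZ ger0_norm ?invr_ge0// mulVf ?gt_eqF.
move=> /(_ h1); congr (op_norm _ <= _).
by apply: eq_bigr => j _; rewrite mxE scalerA.
Qed.

(** With K^2 = P(z), the scaled frame U has U U^T = K^-1 (a^-1 K^2) K^-1 = a^-1 I, hence size d / a,
    and |u_j|^2 = z_j v_j^T K^-2 v_j = 1 / b, which is d / (a n). *)
Lemma frame_scaling_of_sqrt d n (V : 'M[R]_(d, n)) (a b : R) (z : 'cV[R]_n)
    (K : 'M[R]_d) :
  (0 < d)%N -> (0 < n)%N -> 0 < a -> b * d%:R = a * n%:R ->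
  (forall j, 0 < z j 0) -> K \in unitmx -> K^T = K ->
  K *m K = a *: (V *m diag_mx z^T *m V^T) ->
  (forall j, z j 0 * (b * (V^T *m invmx (K *m K) *m V) j j) = 1) ->
  frame_scaling_solution V (invmx K) (diag_mx (\row_j Num.sqrt (z j 0))).
Proof.
move=> d0 n0 a0 bd z0 uK Ksym KK zb.
have du : (d%:R : R) != 0 by rewrite pnatr_eq0 -lt0n.
have nu : (n%:R : R) != 0 by rewrite pnatr_eq0 -lt0n.
have au : a != 0 by rewrite gt_eqF.
set L := invmx K; set S := diag_mx _.
have Lsym : L^T = L by rewrite trmx_inv Ksym.
have Ssym : S^T = S by rewrite tr_diag_mx.
have SS : S *m S = diag_mx z^T.
  rewrite mulmx_diag; congr diag_mx; apply/rowP => j.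
  by rewrite !mxE -expr2 sqr_sqrtr// ltW.
have UU : (L *m V *m S) *m (L *m V *m S)^T = a^-1%:M.
  rewrite !trmx_mul Lsym Ssym !mulmxA -[_ *m S *m S]mulmxA SS.
  rewrite -[L *m V *m _]mulmxA -[L *m _ *m V^T]mulmxA.
  have -> : V *m diag_mx z^T *m V^T = a^-1 *: (K *m K).
    by rewrite KK scalerA mulVf// scale1r.
  rewrite -scalemxAr -scalemxAl mulmxA mulVmx// mul1mx mulmxV//.
  by rewrite scale_scalar_mx mulr1.
have size : frame_size (L *m V *m S) = a^-1 * d%:R.
  by rewrite -mxtrace_gram UU mxtrace_scalar mulr_natr.
split=> //; first by rewrite unitmx_inv.
- exact: diag_mx_is_diag.
- rewrite unitmxE det_diag unitfE; apply/prodf_neq0 => j _.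
  by rewrite mxE sqrtr_eq0 -ltNge.
- apply/doubly_balancedP => //; rewrite UU size; split=> [|j].
    by rewrite mulfK.
  have -> : a^-1 * d%:R / n%:R = b^-1.
    have bu : b != 0.
      by apply: contra_eq_neq bd => ->; rewrite mul0r eq_sym mulf_neq0.
    apply: (canLR (mulfK nu)); apply: (canLR (mulKf au)).
    by rewrite mulrCA -bd mulKf.
  have bz := zb j; apply: (mulfI (_ : b != 0)).
    by apply: contra_eq_neq bz => ->; rewrite mul0r mulr0 eq_sym oner_neq0.
  have LL : invmx (K *m K) = L *m L.
    have uKK : K *m K \in unitmx by rewrite unitmx_mul uK.
    rewrite -[RHS]mulmx1 -(mulmxV uKK) !mulmxA -[L *m L *m K]mulmxA mulVmx//.
    by rewrite mulmx1 mulVmx// mul1mx.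
  rewrite divff; last first.
    by apply: contra_eq_neq bz => ->; rewrite mul0r mulr0 eq_sym oner_neq0.
  rewrite -bz sqr_l2norm_col !trmx_mul Lsym Ssym LL !mulmxA.
  rewrite mul_mx_diag mxE -!mulmxA mul_diag_mx mxE !mxE mulrAC -expr2.
  by rewrite sqr_sqrtr ?ltW// mulrCA.
Qed.

End Scaling.

(** * Normalisation of the frame and choice of constants *)

Theorem theorem2p12 (R : realType) :
  exists C C' : R, [/\ 0 < C, 0 < C' &
    forall (d n : nat) (V : 'M[R]_(d, n)) (eps lam : R),
      frame V ->
      0 <= eps -> eps_doubly_balanced eps V ->
      0 < lam -> lam <= 1 -> infty_expansion lam V ->
      C * eps <= lam ^+ 2 ->
      exists (L : 'M[R]_d) (S : 'M[R]_n),
        frame_scaling_solution V L S /\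
        op_norm (L - 1%:M) <= C' * (eps / lam)].
Proof.
exists 800%:R, 18%:R; split; [by rewrite ltr0n|by rewrite ltr0n|].
move=> d n V eps lam; rewrite /frame /row_full mxrank_tr => /eqP rV eps0 Vbal.
move=> lam0 lam1 Vexp eps_lam.
have e0 : 0 <= eps / lam by rewrite divr_ge0// ltW.
(* For [d = 0] the size and both error matrices vanish, so identity matrices serve; otherwise s(V) >
   0 and dividing by it is meaningful. *)
have [d0|d0] := posnP d.
  subst d; exists 1%:M, 1%:M; split; last first.
    by rewrite subrr op_norm0; apply: mulr_ge0.
  split; [exact: unitmx1|exact: scalar_mx_is_diag|exact: unitmx1|].
  rewrite [_ *m 1%:M]flatmx0 /doubly_balanced /eps_doubly_balanced mulr0.
  rewrite ge_max; apply/andP; split; apply/op_norm_le0; first exact: flatmx0.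
  rewrite /errF frame_sizeE big_ord0 mulmx0 scaler0 -scalemx1 scale0r subr0.
  by apply/matrixP => i j; rewrite !mxE mul0rn.
have n0 : (0 < n)%N by apply: leq_trans d0 _; rewrite -rV rank_leq_col.
have s0 : 0 < frame_size V.
  (* Size zero would force V = 0, of rank 0, whereas the rank is d > 0. *)
  rewrite lt_def sqr_ge0 andbT; apply: contraTneq d0 => sV.
  rewrite -rV (_ : V = 0) ?mxrank0//; apply/matrixP => i j; rewrite mxE.
  move/eqP: sV; rewrite frame_sizeE psumr_eq0.
    move=> /allP/(_ i (mem_index_enum i)) /=.
    rewrite psumr_eq0 => [/allP/(_ j (mem_index_enum j))|k _]; last first.
      exact: sqr_ge0.
    by rewrite /= sqrf_eq0 => /eqP.
  by move=> k _; apply: sumr_ge0 => l _; exact: sqr_ge0.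
set s := frame_size V in s0 *.
have su : s != 0 by rewrite gt_eqF.
have du : (d%:R : R) != 0 by rewrite pnatr_eq0 -lt0n.
have a0 : 0 < d%:R / s by rewrite divr_gt0// ltr0n.
have b0 : 0 <= n%:R / s by rewrite divr_ge0// ltW.
have bd : n%:R / s * d%:R = d%:R / s * n%:R.
  by rewrite mulrAC (mulrC n%:R) mulrAC.
have /andP[EV FV] :
    (op_norm (errE V) <= s * eps) && (op_norm (errF V) <= s * eps).
  by rewrite -ge_max.
have P1 : op_norm (d%:R / s *: (V *m diag_mx (const_mx 1 : 'cV[R]_n)^T *m V^T)
    - 1%:M) <= eps.
  rewrite trmx_const diag_const_mx mulmx1.
  have -> : d%:R / s *: (V *m V^T) - 1%:M = s^-1 *: errE V.
    rewrite /errE scalerBr scalerA mulrC scale_scalar_mx -/s mulVf//.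
  by rewrite op_normZ ger0_norm ?invr_ge0 ?(ltW s0)// ler_pdivrMl.
have bV j : `|n%:R / s * l2norm (col j V) ^+ 2 - 1| <= eps.
  have -> : n%:R / s * l2norm (col j V) ^+ 2 - 1 = s^-1 * errF V j j.
    rewrite sqr_l2norm_col; set G := V^T *m V.
    by rewrite !mxE eqxx !mulr1n -/s mulrBr mulVf// mulrA [s^-1 * _]mulrC.
  rewrite normrM ger0_norm ?invr_ge0 ?(ltW s0)// ler_pdivrMl//.
  exact: le_trans (ler_norm_op_norm _ _ _) FV.
have expn (h : 'cV[R]_n) : \sum_j h j 0 = 0 ->
    op_norm (d%:R / s *: (V *m diag_mx h^T *m V^T)) <= (1 - lam) * `|h|.
  move=> h0; rewrite op_normZ (ger0_norm (ltW a0)) -ler_pdivlMl//.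
  apply: le_trans (infty_expansion_le Vexp h0) _; rewrite -/s.
  rewrite le_eqVlt; apply/orP; left; apply/eqP.
  by rewrite invf_div; ring.
have [z [z1 Pz zb]] :=
  balancing_weights a0 b0 eps0 lam0 lam1 eps_lam bd P1 bV expn.
set e := eps / lam in e0 z1 Pz *.
have e1 : 800%:R * e <= 1.
  by apply: le_trans lam1; rewrite /e mulrA ler_pdivrMr// -expr2.
have v1 : 9%:R * e < 1 by move: e0 e1; clear; lra.
set M := d%:R / s *: _ in Pz zb.
have Msym : M^T = M.
  by rewrite /M linearZ/= !trmx_mul trmxK tr_diag_mx mulmxA.
have [K [Ksym KK Kv]] := near1_symmetric_sqrt Msym Pz v1.
have uK := near1_unitmx Kv v1.
exists (invmx K), (diag_mx (\row_j Num.sqrt (z j 0))); split.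
  apply: (frame_scaling_of_sqrt d0 n0 a0 bd _ uK Ksym KK) => j; last first.
    by rewrite KK; exact: zb.
  (* Positivity of the weights: z_j >= 1 - 8 e > 0. *)
  have := le_trans (ler_norm_mx_norm _ j 0) z1.
  by rewrite !mxE ler_norml => /andP[+ _]; move: e0 v1; clear; lra.
(* The constant 18 arises from 9 e / (1 - 9 e) <= 18 e, valid as 9 e <= 1/2. *)
apply: le_trans (near1_invmx_sub1 Kv v1) _.
by move: e0 e1 v1; clear => e0 e1 v1; rewrite ler_pdivrMr; [nra|lra].
Qed.
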